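(* For all $X,Y,Z,W\in\Gamma(D)$ and $\xi\in\Gamma(D^\bot)$ the following three identities hold. (Gauss) \begin{align*} \widehat{R}(X,Y,Z,W)&=\widehat{R}^D(X,Y,Z,W)-g(B(X,W),B(Y,Z))+g(B(Y,W),B(X,Z))\\ &\quad+g(X,W)\,\omega(B(Y,Z))-g(Y,W)\,\omega(B(X,Z))+g(B(Z,W),[X,Y]). \end{align*} (Codazzi) \begin{align*} \pi^{D^\bot}\big(\widehat{R}(X,Y)Z\big)=&(\widehat{L}^{\bot}_XB)(Y,Z)-(\widehat{L}^{\bot}_YB)(X,Z)-\omega(X)B(Y,Z)+\omega(Y)B(X,Z)\\ &-\pi^{D^{\bot}}[[X,Y]^{D^{\bot}},Z]-L^{\bot}_Z([X,Y]^{D^{\bot}})-\omega(Z)[X,Y]^{D^{\bot}}, \end{align*} where $(\widehat{L}^{\bot}_XB)(Y,Z)=L^{\bot}_X(B(Y,Z))-B(\widehat{\nabla}^D_XY,Z)-B(Y,\widehat{\nabla}^D_XZ)$. (Ricci) $$\pi^{D^\bot}\big(\widehat{R}(X,Y)\xi\big)=-B(X,\widehat{A}_{\xi}Y)+B(Y,\widehat{A}_{\xi}X)+\widehat{R}^{L^{\bot}}(X,Y)\xi,$$ where $\widehat{R}^{L^{\bot}}(X,Y)\xi:=L^{\bot}_XL^{\bot}_Y\xi-L^{\bot}_YL^{\bot}_X\xi-L^{\bot}_{[X,Y]^D}\xi-\pi^{D^{\bot}}\widehat{\nabla}_{[X,Y]^{D^\bot}}\xi$.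
   Context: $(M,g)$ is a smooth Riemannian manifold with Levi-Civita connection $\nabla$. $D\subseteq TM$ is a smooth subbundle (distribution) of constant rank $n$ that is non integrable, i.e. there are $X,Y\in\Gamma(D)$ with $[X,Y]\notin\Gamma(D)$. $D^\bot$ is its orthogonal complement, $\pi^D:TM\to D$ and $\pi^{D^\bot}:TM\to D^\bot$ are the orthogonal projections, $[X,Y]^D=\pi^D[X,Y]$, $[X,Y]^{D^\bot}=\pi^{D^\bot}[X,Y]$. For $X,Y\in\Gamma(D)$, $B(X,Y)=\pi^{D^\bot}(\nabla_XY)$. $U$ is a vector field on $M$, $\omega(V)=g(U,V)$. The semi-symmetric non-metric connection on $M$ is $\widehat\nabla_XY=\nabla_XY+\omega(Y)X$. For $X,Y\in\Gamma(D)$ put $\widehat\nabla^D_XY=\pi^D(\widehat\nabla_XY)$ (one has $\pi^{D^\bot}\widehat\nabla_XY=B(X,Y)$). For $\xi\in\Gamma(D^\bot)$, $A_\xi:\Gamma(D)\to\Gamma(D)$ is defined by $g(A_\xi X,Y)=g(B(X,Y),\xi)$, and $\widehat A_\xi=A_\xi-\omega(\xi)\,\mathrm{Id}$. For $X\in\Gamma(D)$, $\xi\in\Gamma(D^\bot)$ put $L^\bot_X\xi=\pi^{D^\bot}(\nabla_X\xi)$. Curvatures: $\widehat R(X,Y)Z=\widehat\nabla_X\widehat\nabla_YZ-\widehat\nabla_Y\widehat\nabla_XZ-\widehat\nabla_{[X,Y]}Z$ for vector fields on $M$, and for $X,Y,Z\in\Gamma(D)$ $$\widehat R^D(X,Y)Z=\widehat\nabla^D_X\widehat\nabla^D_YZ-\widehat\nabla^D_Y\widehat\nabla^D_XZ-\widehat\nabla^D_{[X,Y]^D}Z-\pi^D[[X,Y]^{D^\bot},Z].$$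 Also $\widehat R(X,Y,Z,W)=g(\widehat R(X,Y)Z,W)$ and $\widehat R^D(X,Y,Z,W)=g(\widehat R^D(X,Y)Z,W)$. *)

(* Defs.v *)
From HB Require Import structures.
From mathcomp Require Import all_boot all_order all_algebra.
From mathcomp Require Import all_classical all_reals all_analysis.
From mathcomp Require Import ring.

Set Implicit Arguments.
Unset Strict Implicit.
Unset Printing Implicit Defensive.
Import Order.TTheory GRing.Theory Num.Theory.
Import numFieldNormedType.Exports.
Local Open Scope classical_set_scope.
Local Open Scope ring_scope.

(* Smooth functions on open subsets of R^m. The set [V] is always meant to be
   open, so that the partial derivatives at points of [V] only depend on
   the restriction of [f] to [V]. *)
Section Smooth_Rm.
Context {R : realType} {m : nat}.
Implicit Types (V : set 'rV[R]_m) (f g : 'rV[R]_m -> R).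

Fixpoint Ck_on (k : nat) V f : Prop :=
  (forall x, V x -> {for x, continuous f}) /\
  if k is k'.+1 then
    forall i : 'I_m, (forall x, V x -> derivable f x (delta_mx 0 i)) /\
      Ck_on k' V ('D_(delta_mx 0 i) f)
  else True.

Definition Cinfty_on V f := forall k, Ck_on k V f.

Lemma Ck_on_continuous k V f x : Ck_on k V f -> V x -> {for x, continuous f}.
Proof. by case: k => [|k] [+ _]; exact. Qed.

Lemma Ck_onW k V f : Ck_on k.+1 V f -> Ck_on k V f.
Proof.
elim: k f => [|k IH] f [cf df]; first by split.
by split=> // i; have [dfi /IH] := df i.
Qed.

Lemma Ck_on_local k V f :
  (forall x, V x -> exists2 V', V' x & Ck_on k V' f) -> Ck_on k V f.
Proof.
elim: k f => [|k IH] f loc /=.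
  split=> // x Vx; have [V' V'x /Ck_on_continuous] := loc _ Vx; exact.
split=> [x Vx|i].
  by have [V' V'x /Ck_on_continuous] := loc _ Vx; exact.
split=> [x Vx|].
  by have [V' V'x [_ /(_ i)[+ _]]] := loc _ Vx; exact.
by apply: IH => x /loc[V' V'x [_ /(_ i)[_ ?]]]; exists V'.
Qed.

Lemma Ck_onS k V V' f : V' `<=` V -> Ck_on k V f -> Ck_on k V' f.
Proof. by move=> V'V Vf; apply: Ck_on_local => x /V'V Vx; exists V. Qed.

Lemma Ck_on_eq k V f g :
  open V -> (forall x, V x -> f x = g x) -> Ck_on k V f -> Ck_on k V g.
Proof.
move=> oV; have nearV x h1 h2 : (forall x, V x -> h1 x = h2 x :> R) -> V x ->
    \near x, h1 x = h2 x.
  move=> e Vx; have := open_nbhs_nbhs (conj oV Vx).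
  by apply: filterS => y; exact: e.
have ceq h1 h2 x : (forall x, V x -> h1 x = h2 x :> R) -> V x ->
    {for x, continuous h1} -> {for x, continuous h2}.
  move=> e Vx ch; rewrite /prop_for /continuous_at -(e _ Vx).
  exact: (cvg_trans (near_eq_cvg (nearV _ _ _ e Vx)) ch).
elim: k f g => [|k IH] f g e [cf df] /=.
  by split=> // x Vx; exact: ceq e Vx (cf _ Vx).
split=> [x Vx|i]; first exact: ceq e Vx (cf _ Vx).
have [dfi Dfi] := df i; split=> [x Vx|].
  by apply: near_eq_derivable (dfi _ Vx); exact: nearV e Vx.
apply: IH Dfi => x Vx; apply: near_eq_derive; exact: nearV e Vx.
Qed.

Lemma Ck_on_cst k V (a : R) : Ck_on k V (fun=> a).
Proof.
elim: k a => [|k IH] a /=; first by split=> // x _; exact: cst_continuous.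
split=> [x _|i]; first exact: cst_continuous.
split=> [x _|]; first exact: derivable_cst.
rewrite (_ : 'D__ _ = fun=> 0); first exact: IH.
by apply/funext => x; rewrite (derive_cst a).
Qed.

Lemma Ck_onD k V f g : open V -> Ck_on k V f -> Ck_on k V g ->
  Ck_on k V (fun x => f x + g x).
Proof.
move=> oV; elim: k f g => [|k IH] f g [cf df] [cg dg] /=.
  by split=> // x Vx; apply: continuousD; [exact: cf|exact: cg].
split=> [x Vx|i]; first by apply: continuousD; [exact: cf|exact: cg].
have [dfi Dfi] := df i; have [dgi Dgi] := dg i; split=> [x Vx|].
  by apply: derivableD; [exact: dfi|exact: dgi].
apply: Ck_on_eq (IH _ _ Dfi Dgi) => // x Vx.
by rewrite deriveD//; [exact: dfi|exact: dgi].
Qed.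

Lemma Ck_onM k V f g : open V -> Ck_on k V f -> Ck_on k V g ->
  Ck_on k V (fun x => f x * g x).
Proof.
move=> oV; elim: k f g => [|k IH] f g Cf Cg.
  by split=> // x Vx; apply: continuousM;
    [exact: Ck_on_continuous Cf Vx|exact: Ck_on_continuous Cg Vx].
split=> [x Vx|i]; first by apply: continuousM;
    [exact: Ck_on_continuous Cf Vx|exact: Ck_on_continuous Cg Vx].
case: (Cf) => _ /(_ i)[dfi Dfi]; case: (Cg) => _ /(_ i)[dgi Dgi].
split=> [x Vx|]; first by apply: derivableM; [exact: dfi|exact: dgi].
apply: (@Ck_on_eq _ _ (fun x => f x * 'D_(delta_mx 0 i) g x +
  g x * 'D_(delta_mx 0 i) f x)) => // [x Vx|].
  by rewrite deriveM//; [exact: dfi|exact: dgi].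
by apply: Ck_onD => //; apply: IH => //; exact: Ck_onW.
Qed.

Lemma Ck_onV k V f : open V -> (forall x, V x -> f x != 0) ->
  Ck_on k V f -> Ck_on k V (fun x => (f x)^-1).
Proof.
move=> oV f0; elim: k => [|k IH] Cf.
  by split=> // x Vx; apply: continuousV; [exact: f0|exact: Ck_on_continuous Cf Vx].
split=> [x Vx|i].
  by apply: continuousV; [exact: f0|exact: Ck_on_continuous Cf Vx].
case: (Cf) => _ /(_ i)[dfi Dfi]; split=> [x Vx|].
  by apply: derivableV; [exact: f0|exact: dfi].
apply: (@Ck_on_eq _ _ (fun x => - 1 * ((f x)^-1 * (f x)^-1) *
  'D_(delta_mx 0 i) f x)) => // [x Vx|].
  rewrite deriveV//; [|exact: f0|exact: dfi].
  by rewrite /GRing.scale/= expr2 invfM mulN1r.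
have CV := IH (Ck_onW Cf).
do 2![apply: Ck_onM => //]; [exact: Ck_on_cst|exact: Ck_onM].
Qed.

End Smooth_Rm.

(* [chart_inv] is only meaningful on the open set [chart_im], where it is
   the inverse of [chart_map]. *)
Record chart (R : realType) (m : nat) (M : topologicalType) := Chart {
  chart_dom : set M;
  chart_map : M -> 'rV[R]_m;
  chart_inv : 'rV[R]_m -> M;
  chart_dom_open : open chart_dom;
  chart_im_open : open (chart_map @` chart_dom);
  chart_mapK : forall x, chart_dom x -> chart_inv (chart_map x) = x;
  chart_map_cont : forall x, chart_dom x -> {for x, continuous chart_map};
  chart_inv_cont : forall y, (chart_map @` chart_dom) y ->
    {for y, continuous chart_inv} }.

Record smoothManifold (R : realType) (m : nat) := SmoothManifold {
  man_carrier :> topologicalType;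
  man_hausdorff : hausdorff_space man_carrier;
  man_second_countable : @second_countable man_carrier;
  man_atlas : set (chart R m man_carrier);
  man_atlas_cover : forall x, exists2 c, man_atlas c & chart_dom c x;
  man_atlas_compat : forall c d, man_atlas c -> man_atlas d ->
    forall j : 'I_m,
      Cinfty_on (chart_map c @` (chart_dom c `&` chart_dom d))
                (fun y => chart_map d (chart_inv c y) 0 j) }.

Section SmoothFunctions.
Context {R : realType} {m : nat} {M : smoothManifold R m}.
Implicit Types (U : set M) (f g : M -> R).

Definition smooth_on U f := forall c, man_atlas c ->
  Cinfty_on (chart_map c @` (U `&` chart_dom c)) (f \o chart_inv c).

Lemma chart_im_openI (c : chart R m M) U :
  open U -> open (chart_map c @` (U `&` chart_dom c)).
Proof.
move=> oU; rewrite openE => _ [x [Ux cx] <-].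
have [im1 im2] : open_nbhs (chart_map c x) (chart_map c @` chart_dom c).
  by split; [exact: chart_im_open|exists x].
have /(_ U) := chart_inv_cont im2.
rewrite /= chart_mapK// => /(_ (open_nbhs_nbhs (conj oU Ux))) nU.
have nI := open_nbhs_nbhs (conj im1 im2).
have : nbhs (chart_map c x)
    ((chart_inv c @^-1` U) `&` (chart_map c @` chart_dom c)) by exact: filterI.
apply: filterS => z [/= Uz [y cy yz]]; exists y => //; split=> //.
by move: Uz; rewrite -yz chart_mapK.
Qed.

Lemma smooth_on_local U f :
  (forall p, U p -> exists2 U', U' p & smooth_on U' f) -> smooth_on U f.
Proof.
move=> loc c cA k; apply: Ck_on_local => _ [p [Up cp] <-].
have [U' U'p fU'] := loc _ Up.
by exists (chart_map c @` (U' `&` chart_dom c)); [exists p|exact: fU'].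
Qed.

Lemma smooth_onS U U' f : U' `<=` U -> smooth_on U f -> smooth_on U' f.
Proof. by move=> U'U Uf; apply: smooth_on_local => p /U'U Up; exists U. Qed.

Lemma smooth_on_eq U f g : open U -> (forall p, U p -> f p = g p) ->
  smooth_on U f -> smooth_on U g.
Proof.
move=> oU fg sf c cA k; apply: Ck_on_eq (sf c cA k).
  exact: chart_im_openI.
by move=> _ [p [Up cp] <-] /=; rewrite chart_mapK// fg.
Qed.

Lemma smooth_on_cst U (a : R) : smooth_on U (fun=> a).
Proof. by move=> c cA k; exact: Ck_on_cst. Qed.

Lemma smooth_onD U f g : open U -> smooth_on U f -> smooth_on U g ->
  smooth_on U (fun p => f p + g p).
Proof.
move=> oU sf sg c cA k; apply: Ck_onD; first exact: chart_im_openI.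
- exact: sf.
- exact: sg.
Qed.

Lemma smooth_onM U f g : open U -> smooth_on U f -> smooth_on U g ->
  smooth_on U (fun p => f p * g p).
Proof.
move=> oU sf sg c cA k; apply: Ck_onM; first exact: chart_im_openI.
- exact: sf.
- exact: sg.
Qed.

Lemma smooth_onV U f : open U -> (forall p, U p -> f p != 0) ->
  smooth_on U f -> smooth_on U (fun p => (f p)^-1).
Proof.
move=> oU f0 sf c cA k; apply: Ck_onV; first exact: chart_im_openI.
- by move=> _ [p [Up cp] <-] /=; rewrite chart_mapK// f0.
- exact: sf.
Qed.

Lemma smooth_onN U f : open U -> smooth_on U f -> smooth_on U (fun p => - f p).
Proof.
move=> oU sf; apply: (@smooth_on_eq _ (fun p => -1 * f p)) => //.
  by move=> p _; rewrite mulN1r.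
by apply: smooth_onM => //; exact: smooth_on_cst.
Qed.

Lemma smooth_on_sum U (I : Type) (r : seq I) (P : pred I) (F : I -> M -> R) :
  open U -> (forall i, smooth_on U (F i)) ->
  smooth_on U (fun p => \sum_(i <- r | P i) F i p).
Proof.
move=> oU sF; elim: r => [|i r IH].
  apply: (smooth_on_eq (f := fun=> 0)) => // [p _|]; first by rewrite big_nil.
  exact: smooth_on_cst.
case Pi : (P i).
  apply: (smooth_on_eq (f := fun p => F i p + \sum_(i <- r | P i) F i p)) => //.
    by move=> p _; rewrite big_cons Pi.
  exact: smooth_onD.
by apply: (smooth_on_eq oU) IH => p _; rewrite big_cons Pi.
Qed.

Lemma smooth_on_prod U (I : Type) (r : seq I) (P : pred I) (F : I -> M -> R) :
  open U -> (forall i, smooth_on U (F i)) ->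
  smooth_on U (fun p => \prod_(i <- r | P i) F i p).
Proof.
move=> oU sF; elim: r => [|i r IH].
  apply: (smooth_on_eq (f := fun=> 1)) => // [p _|]; first by rewrite big_nil.
  exact: smooth_on_cst.
case Pi : (P i).
  apply: (smooth_on_eq (f := fun p => F i p * \prod_(i <- r | P i) F i p)) => //.
    by move=> p _; rewrite big_cons Pi.
  exact: smooth_onM.
by apply: (smooth_on_eq oU) IH => p _; rewrite big_cons Pi.
Qed.

Lemma smooth_on_det U k (A : M -> 'M[R]_k) :
  open U -> (forall i j, smooth_on U (fun p => A p i j)) ->
  smooth_on U (fun p => \det (A p)).
Proof.
move=> oU sA; apply: smooth_on_sum => // s; apply: smooth_onM => //.
  exact: smooth_on_cst.
exact: smooth_on_prod.
Qed.

Lemma smooth_on_invmx U k (A : M -> 'M[R]_k) :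
  open U -> (forall p, U p -> A p \in unitmx) ->
  (forall i j, smooth_on U (fun p => A p i j)) ->
  forall i j, smooth_on U (fun p => invmx (A p) i j).
Proof.
move=> oU uA sA i j.
apply: (smooth_on_eq (f := fun p => (\det (A p))^-1 *
    ((-1) ^+ (j + i) * \det (row' j (col' i (A p)))))) => //.
  by move=> p Up; rewrite /invmx uA// !mxE.
apply: smooth_onM => //.
  apply: smooth_onV => // [p /uA|]; first by rewrite unitmxE unitfE.
  exact: smooth_on_det.
apply: smooth_onM => //; first exact: smooth_on_cst.
apply: smooth_on_det => // i' j'.
by apply: (smooth_on_eq oU) (sA (lift j i') (lift i j')) => p _; rewrite !mxE.
Qed.

End SmoothFunctions.

Record Cinfty (R : realType) (m : nat) (M : smoothManifold R m) := MkCinfty {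
  Cinfty_fun :> M -> R;
  Cinfty_smooth : smooth_on [set: M] Cinfty_fun }.

Section CinftyAlgebra.
Context {R : realType} {m : nat} {M : smoothManifold R m}.
Local Notation C := (Cinfty M).
Implicit Types f g h : C.

Lemma Cinfty_eq f g : (forall p, f p = g p) -> f = g.
Proof.
case: f g => [f sf] [g sg] /= /funext fg.
by move: sf sg; rewrite fg => sf sg; congr MkCinfty; exact: Prop_irrelevance.
Qed.

HB.instance Definition _ := gen_eqMixin C.
HB.instance Definition _ := gen_choiceMixin C.

Definition Cinfty_cst (a : R) : C := MkCinfty (@smooth_on_cst _ _ M setT a).
Definition Cinfty_add f g : C :=
  MkCinfty (smooth_onD openT (Cinfty_smooth f) (Cinfty_smooth g)).
Definition Cinfty_opp f : C := MkCinfty (smooth_onN openT (Cinfty_smooth f)).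
Definition Cinfty_mul f g : C :=
  MkCinfty (smooth_onM openT (Cinfty_smooth f) (Cinfty_smooth g)).

Fact Cinfty_addA : associative Cinfty_add.
Proof. by move=> f g h; apply: Cinfty_eq => p /=; rewrite addrA. Qed.
Fact Cinfty_addC : commutative Cinfty_add.
Proof. by move=> f g; apply: Cinfty_eq => p /=; rewrite addrC. Qed.
Fact Cinfty_add0 : left_id (Cinfty_cst 0) Cinfty_add.
Proof. by move=> f; apply: Cinfty_eq => p /=; rewrite add0r. Qed.
Fact Cinfty_addN : left_inverse (Cinfty_cst 0) Cinfty_opp Cinfty_add.
Proof. by move=> f; apply: Cinfty_eq => p /=; rewrite addNr. Qed.

HB.instance Definition _ := GRing.isZmodule.Build C
  Cinfty_addA Cinfty_addC Cinfty_add0 Cinfty_addN.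

Fact Cinfty_mulA : associative Cinfty_mul.
Proof. by move=> f g h; apply: Cinfty_eq => p /=; rewrite mulrA. Qed.
Fact Cinfty_mulC : commutative Cinfty_mul.
Proof. by move=> f g; apply: Cinfty_eq => p /=; rewrite mulrC. Qed.
Fact Cinfty_mul1 : left_id (Cinfty_cst 1) Cinfty_mul.
Proof. by move=> f; apply: Cinfty_eq => p /=; rewrite mul1r. Qed.
Fact Cinfty_mulr1 : right_id (Cinfty_cst 1) Cinfty_mul.
Proof. by move=> f; apply: Cinfty_eq => p /=; rewrite mulr1. Qed.
Fact Cinfty_mulDl : left_distributive Cinfty_mul +%R.
Proof. by move=> f g h; apply: Cinfty_eq => p /=; rewrite mulrDl. Qed.
Fact Cinfty_mulDr : right_distributive Cinfty_mul +%R.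
Proof. by move=> f g h; apply: Cinfty_eq => p /=; rewrite mulrDr. Qed.

HB.instance Definition _ := GRing.Zmodule_isPzRing.Build C
  Cinfty_mulA Cinfty_mul1 Cinfty_mulr1 Cinfty_mulDl Cinfty_mulDr.
HB.instance Definition _ := GRing.PzRing_hasCommutativeMul.Build C Cinfty_mulC.

Definition Cinfty_scale (a : R) f : C := Cinfty_cst a * f.

Fact Cinfty_scaleA a b f :
  Cinfty_scale a (Cinfty_scale b f) = Cinfty_scale (a * b) f.
Proof. by apply: Cinfty_eq => p /=; rewrite mulrA. Qed.
Fact Cinfty_scale1 : left_id 1 Cinfty_scale.
Proof. by move=> f; exact: mul1r. Qed.
Fact Cinfty_scaleDr : right_distributive Cinfty_scale +%R.
Proof. by move=> a f g; exact: mulrDr. Qed.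
Fact Cinfty_scaleDl f : {morph Cinfty_scale^~ f : a b / a + b}.
Proof. by move=> a b; apply: Cinfty_eq => p /=; rewrite mulrDl. Qed.

HB.instance Definition _ := GRing.Zmodule_isLmodule.Build R C
  Cinfty_scaleA Cinfty_scale1 Cinfty_scaleDr Cinfty_scaleDl.

Lemma CinftyD f g p : (f + g) p = f p + g p. Proof. by []. Qed.
Lemma CinftyN f p : (- f) p = - f p. Proof. by []. Qed.
Lemma CinftyM f g p : (f * g) p = f p * g p. Proof. by []. Qed.
Lemma CinftyZ (a : R) f p : (a *: f) p = a * f p. Proof. by []. Qed.
Lemma Cinfty0 p : (0 : C) p = 0. Proof. by []. Qed.

End CinftyAlgebra.

(* Tangent vectors at p are the derivations at p of the algebra of smooth
   functions on M. *)
Record tangent (R : realType) (m : nat) (M : smoothManifold R m) (p : M) :=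
  MkTangent {
    tangent_fun :> Cinfty M -> R;
    tangent_linear : forall (a : R) (f g : Cinfty M),
      tangent_fun (a *: f + g) = a * tangent_fun f + tangent_fun g;
    tangent_leibniz : forall f g : Cinfty M,
      tangent_fun (f * g) = f p * tangent_fun g + g p * tangent_fun f }.

Section TangentSpace.
Context {R : realType} {m : nat} {M : smoothManifold R m} {p : M}.
Local Notation T := (tangent p).
Implicit Types u v w : T.

Lemma tangent_eq u v : (forall f, u f = v f) -> u = v.
Proof.
case: u v => [u lu du] [v lv dv] /= /funext uv.
by move: lu du lv dv; rewrite uv => *; congr MkTangent; exact: Prop_irrelevance.
Qed.

HB.instance Definition _ := gen_eqMixin T.
HB.instance Definition _ := gen_choiceMixin T.

Program Definition tangent_zero : T := @MkTangent _ _ _ p (fun=> 0) _ _.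
Next Obligation. by move=> * /=; rewrite mulr0 addr0. Qed.
Next Obligation. by move=> * /=; rewrite !mulr0 addr0. Qed.

Program Definition tangent_add u v : T :=
  @MkTangent _ _ _ p (fun f => u f + v f) _ _.
Next Obligation. by move=> * /=; rewrite !tangent_linear mulrDr addrACA. Qed.
Next Obligation. by move=> * /=; rewrite !tangent_leibniz !mulrDr addrACA. Qed.

Program Definition tangent_scale (a : R) v : T :=
  @MkTangent _ _ _ p (fun f => a * v f) _ _.
Next Obligation. by move=> * /=; rewrite tangent_linear mulrDr mulrCA. Qed.
Next Obligation.
by move=> * /=; rewrite tangent_leibniz mulrDr; congr +%R; rewrite mulrCA.
Qed.

Definition tangent_opp v := tangent_scale (-1) v.

Fact tangent_addA : associative tangent_add.
Proof. by move=> u v w; apply: tangent_eq => f /=; rewrite addrA. Qed.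
Fact tangent_addC : commutative tangent_add.
Proof. by move=> u v; apply: tangent_eq => f /=; rewrite addrC. Qed.
Fact tangent_add0 : left_id tangent_zero tangent_add.
Proof. by move=> u; apply: tangent_eq => f /=; rewrite add0r. Qed.
Fact tangent_addN : left_inverse tangent_zero tangent_opp tangent_add.
Proof. by move=> u; apply: tangent_eq => f /=; rewrite mulN1r addNr. Qed.

HB.instance Definition _ := GRing.isZmodule.Build T
  tangent_addA tangent_addC tangent_add0 tangent_addN.

Fact tangent_scaleA a b v :
  tangent_scale a (tangent_scale b v) = tangent_scale (a * b) v.
Proof. by apply: tangent_eq => f /=; rewrite mulrA. Qed.
Fact tangent_scale1 : left_id 1 tangent_scale.
Proof. by move=> v; apply: tangent_eq => f /=; rewrite mul1r. Qed.
Fact tangent_scaleDr : right_distributive tangent_scale +%R.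
Proof. by move=> a u v; apply: tangent_eq => f /=; rewrite mulrDr. Qed.
Fact tangent_scaleDl v : {morph tangent_scale^~ v : a b / a + b}.
Proof. by move=> a b; apply: tangent_eq => f /=; rewrite mulrDl. Qed.

HB.instance Definition _ := GRing.Zmodule_isLmodule.Build R T
  tangent_scaleA tangent_scale1 tangent_scaleDr tangent_scaleDl.

Lemma tangent0E f : (0 : T) f = 0. Proof. by []. Qed.
Lemma tangentDE u v f : (u + v) f = u f + v f. Proof. by []. Qed.
Lemma tangentZE (a : R) v f : (a *: v) f = a * v f. Proof. by []. Qed.
Lemma tangentNE v f : (- v) f = - v f.
Proof. by rewrite -[LHS]/(-1 * v f) mulN1r. Qed.
Lemma tangentBE u v f : (u - v) f = u f - v f.
Proof. by rewrite tangentDE tangentNE. Qed.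
Lemma tangent_sumE (I : Type) (r : seq I) (P : pred I) (F : I -> T) f :
  (\sum_(i <- r | P i) F i) f = \sum_(i <- r | P i) F i f.
Proof. by elim/big_rec2: _ => // i y1 y2 _ <-. Qed.

Lemma tangentD v f g : v (f + g) = v f + v g.
Proof. by rewrite -{1}(scale1r f) tangent_linear mul1r. Qed.
Lemma tangentN v f : v (- f) = - v f.
Proof.
by apply/eqP; rewrite -subr_eq0 opprK addrC -tangentD subrr; apply/eqP;
  apply: (addIr (v 0)); rewrite -tangentD !add0r.
Qed.
Lemma tangentB v f g : v (f - g) = v f - v g.
Proof. by rewrite tangentD tangentN. Qed.

End TangentSpace.

(* Testing against globally defined functions is enough even when [U] is a
   proper open subset: M has smooth bump functions, so local coordinates extend
   to global smooth functions near each point of [U]. *)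
Definition smooth_section_on (R : realType) (m : nat) (M : smoothManifold R m)
    (U : set M) (X : forall p : M, tangent p) :=
  forall f : Cinfty M, smooth_on U (fun p => X p f).

Record vfield (R : realType) (m : nat) (M : smoothManifold R m) := MkVfield {
  vfield_at :> forall p : M, tangent p;
  vfield_smooth : smooth_section_on [set: M] vfield_at }.

Section VectorFields.
Context {R : realType} {m : nat} {M : smoothManifold R m}.
Local Notation C := (Cinfty M).
Local Notation VF := (vfield M).
Implicit Types (X Y Z : VF) (f g : C).

Lemma vfield_eq X Y : (forall p, X p = Y p) -> X = Y.
Proof.
case: X Y => [X sX] [Y sY] /= XY.
have {}XY : X = Y by exact: functional_extensionality_dep.
by move: sX sY; rewrite XY => *; congr MkVfield; exact: Prop_irrelevance.
Qed.

HB.instance Definition _ := gen_eqMixin VF.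
HB.instance Definition _ := gen_choiceMixin VF.

Program Definition vfield_zero : VF := @MkVfield _ _ M (fun=> 0) _.
Next Obligation. by move=> f; exact: smooth_on_cst. Qed.

Program Definition vfield_add X Y : VF := @MkVfield _ _ M (fun p => X p + Y p) _.
Next Obligation.
by move=> X Y f; apply: smooth_onD; [exact: openT|exact: vfield_smooth..].
Qed.

Program Definition vfield_scale f X : VF := @MkVfield _ _ M (fun p => f p *: X p) _.
Next Obligation.
move=> f X h; apply: smooth_onM; first exact: openT.
- exact: Cinfty_smooth.
- exact: vfield_smooth.
Qed.

Definition vfield_opp X := vfield_scale (-1) X.

Fact vfield_addA : associative vfield_add.
Proof. by move=> X Y Z; apply: vfield_eq => p /=; rewrite addrA. Qed.
Fact vfield_addC : commutative vfield_add.
Proof. by move=> X Y; apply: vfield_eq => p /=; rewrite addrC. Qed.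
Fact vfield_add0 : left_id vfield_zero vfield_add.
Proof. by move=> X; apply: vfield_eq => p /=; rewrite add0r. Qed.
Fact vfield_addN : left_inverse vfield_zero vfield_opp vfield_add.
Proof. by move=> X; apply: vfield_eq => p /=; rewrite scaleN1r addNr. Qed.

HB.instance Definition _ := GRing.isZmodule.Build VF
  vfield_addA vfield_addC vfield_add0 vfield_addN.

Fact vfield_scaleA f g X :
  vfield_scale f (vfield_scale g X) = vfield_scale (f * g) X.
Proof. by apply: vfield_eq => p /=; rewrite scalerA. Qed.
Fact vfield_scale1 : left_id 1 vfield_scale.
Proof. by move=> X; apply: vfield_eq => p /=; rewrite scale1r. Qed.
Fact vfield_scaleDr : right_distributive vfield_scale +%R.
Proof. by move=> f X Y; apply: vfield_eq => p /=; rewrite scalerDr. Qed.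
Fact vfield_scaleDl X : {morph vfield_scale^~ X : f g / f + g}.
Proof. by move=> f g; apply: vfield_eq => p /=; rewrite scalerDl. Qed.

HB.instance Definition _ := GRing.Zmodule_isLmodule.Build C VF
  vfield_scaleA vfield_scale1 vfield_scaleDr vfield_scaleDl.

Lemma vfield0E p : (0 : VF) p = 0. Proof. by []. Qed.
Lemma vfieldDE X Y p : (X + Y) p = X p + Y p. Proof. by []. Qed.
Lemma vfieldZE f X p : (f *: X) p = f p *: X p. Proof. by []. Qed.
Lemma vfieldNE X p : (- X) p = - X p.
Proof. by rewrite -[LHS]/((-1 : R) *: X p) scaleN1r. Qed.
Lemma vfieldBE X Y p : (X - Y) p = X p - Y p.
Proof. by rewrite vfieldDE vfieldNE. Qed.

Definition vfield_app X f : C := MkCinfty (vfield_smooth X f).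

Program Definition bracket X Y : VF := @MkVfield _ _ M (fun p =>
  @MkTangent _ _ _ p
    (fun f => X p (vfield_app Y f) - Y p (vfield_app X f)) _ _) _.
Next Obligation.
move=> X Y p a f g.
have lin Z : vfield_app Z (a *: f + g) = a *: vfield_app Z f + vfield_app Z g.
  by apply: Cinfty_eq => q; exact: tangent_linear.
by rewrite !lin !tangent_linear mulrBr opprD addrACA.
Qed.
Next Obligation.
move=> X Y p f g.
have leib Z : vfield_app Z (f * g) = f * vfield_app Z g + g * vfield_app Z f.
  by apply: Cinfty_eq => q; exact: tangent_leibniz.
rewrite !leib !tangentD !tangent_leibniz /=; ring.
Qed.
Next Obligation.
move=> X Y f; apply: smooth_onD; first exact: openT.
  exact: vfield_smooth X (vfield_app Y f).
by apply: smooth_onN; [exact: openT|exact: vfield_smooth Y (vfield_app X f)].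
Qed.

End VectorFields.

Record riemannianMetric (R : realType) (m : nat) (M : smoothManifold R m) :=
  RiemannianMetric {
    metric_at :> forall p : M, tangent p -> tangent p -> R;
    metric_linear : forall p (a : R) (u v w : tangent p),
      metric_at (a *: u + v) w = a * metric_at u w + metric_at v w;
    metric_sym : forall p (u v : tangent p), metric_at u v = metric_at v u;
    metric_pos : forall p (u : tangent p), u != 0 -> 0 < metric_at u u;
    metric_smooth : forall (U : set M) (X Y : forall p : M, tangent p),
      open U -> smooth_section_on U X -> smooth_section_on U Y ->
      smooth_on U (fun p => metric_at (X p) (Y p)) }.

(* A smooth rank n subbundle of TM: near every point, the fibres have a basis
   [E] of smooth sections, which are only required to be smooth on [U]. *)
Record subbundle (R : realType) (m : nat) (M : smoothManifold R m) (n : nat) :=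
  Subbundle {
    fibre :> forall p : M, set (tangent p);
    local_frame : forall p : M, exists (U : set M)
        (E : 'I_n -> forall q : M, tangent q),
      [/\ open U, U p, forall i, smooth_section_on U (E i) &
        forall q, U q ->
          (forall v : tangent q,
             fibre v <-> exists a : 'I_n -> R, v = \sum_i a i *: E i q) /\
          (forall a : 'I_n -> R, \sum_i a i *: E i q = 0 -> forall i, a i = 0)] }.

Section MetricGeometry.
Context {R : realType} {m : nat} {M : smoothManifold R m}.
Variable g : riemannianMetric M.
Local Notation VF := (vfield M).
Implicit Types (X Y Z W U V xi : VF).

Definition metric_vf X Y : Cinfty M :=
  MkCinfty (metric_smooth g openT (vfield_smooth X) (vfield_smooth Y)).

Lemma metricD p (u v w : tangent p) : g p (u + v) w = g p u w + g p v w.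
Proof. by rewrite -{1}(scale1r u) metric_linear mul1r. Qed.
Lemma metric0 p (w : tangent p) : g p 0 w = 0.
Proof. by apply: (addIr (g p 0 w)); rewrite -metricD !add0r. Qed.
Lemma metricZ p a (u w : tangent p) : g p (a *: u) w = a * g p u w.
Proof. by rewrite -[a *: u]addr0 metric_linear metric0 addr0. Qed.
Lemma metricB p (u v w : tangent p) : g p (u - v) w = g p u w - g p v w.
Proof. by rewrite metricD -scaleN1r metricZ mulN1r. Qed.
Lemma metric_sum p (I : Type) (r : seq I) (P : pred I) (F : I -> tangent p) w :
  g p (\sum_(i <- r | P i) F i) w = \sum_(i <- r | P i) g p (F i) w.
Proof. by elim/big_rec2: _ => [|i y1 y2 _ <-]; rewrite ?metric0 ?metricD. Qed.

Record affine_connection (nabla : VF -> VF -> VF) : Prop := {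
  connection_linearl : forall (f : Cinfty M) X Y Z,
    nabla (f *: X + Y) Z = f *: nabla X Z + nabla Y Z;
  connection_addr : forall X Y Z, nabla X (Y + Z) = nabla X Y + nabla X Z;
  connection_leibniz : forall (f : Cinfty M) X Y,
    nabla X (f *: Y) = vfield_app X f *: Y + f *: nabla X Y }.

Record levi_civita (nabla : VF -> VF -> VF) : Prop := {
  levi_civita_connection : affine_connection nabla;
  levi_civita_torsion_free : forall X Y, nabla X Y - nabla Y X = bracket X Y;
  levi_civita_metric : forall X Y Z,
    vfield_app X (metric_vf Y Z) =
      metric_vf (nabla X Y) Z + metric_vf Y (nabla X Z) }.

Definition curvature (nabla : VF -> VF -> VF) X Y Z : VF :=
  nabla X (nabla Y Z) - nabla Y (nabla X Z) - nabla (bracket X Y) Z.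

(* ssnm: semi-symmetric non-metric connection *)
Definition ssnm (nabla : VF -> VF -> VF) U X Y : VF :=
  nabla X Y + metric_vf U Y *: X.

Section Subbundle.
Context {n : nat}.
Variable D : subbundle M n.

Definition orth_compl p : set (tangent p) :=
  [set v | forall w, D p w -> g p v w = 0].

Definition in_distr X := forall p, D p (X p).
Definition in_orth X := forall p, orth_compl (X p).

Definition non_integrable := exists X Y,
  [/\ in_distr X, in_distr Y & ~ in_distr (bracket X Y)].

Definition proj_at p (v : tangent p) : tangent p :=
  xget 0 [set w | D p w /\ orth_compl (v - w)].

Lemma fibre_closed p (a : R) (u v : tangent p) :
  D p u -> D p v -> D p (a *: u + v).
Proof.
have [U [E [_ Up _ /(_ p Up)[DE _]]]] := local_frame D p.
move=> /DE[b ->] /DE[c ->]; apply/DE; exists (fun i => a * b i + c i).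
rewrite scaler_sumr -big_split; apply: eq_bigr => i _ /=.
by rewrite scalerDl scalerA.
Qed.

Lemma proj_at_unique p (v w : tangent p) :
  D p w -> orth_compl (v - w) -> proj_at v = w.
Proof.
move=> Dw vw; apply: xget_unique => // w' [Dw' vw'].
apply/eqP; rewrite -subr_eq0; apply/negPn/negP => /(metric_pos g).
have Dww' : D p (w' - w).
  by rewrite addrC -scaleN1r; exact: fibre_closed.
rewrite (_ : g p _ _ = 0) ?ltxx//.
rewrite {1}(_ : w' - w = (v - w) - (v - w')); last first.
  by rewrite opprB [RHS]addrC addrA subrK.
by rewrite metricB vw// vw'// subrr.
Qed.

Section LocalFrame.
Variables (U : set M) (E : 'I_n -> forall q : M, tangent q).
Hypotheses (oU : open U) (sE : forall i, smooth_section_on U (E i)).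
Hypothesis frameE : forall q, U q ->
  (forall v : tangent q,
     D q v <-> exists a : 'I_n -> R, v = \sum_i a i *: E i q) /\
  (forall a : 'I_n -> R, \sum_i a i *: E i q = 0 -> forall i, a i = 0).

Let gram (q : M) : 'M[R]_n := \matrix_(i, j) g q (E i q) (E j q).

Let gram_unit q : U q -> gram q \in unitmx.
Proof.
move=> Uq; rewrite -row_free_unit; apply/row_freeP.
suff : kermx (gram q) = 0.
  by move/eqP; rewrite kermx_eq0 => /row_freeP.
apply/row_matrixP => k; rewrite row0; set c := row k _.
have cG : c *m gram q = 0.
  by apply/sub_kermxP; exact: row_sub.
have [_ /(_ (fun i => c 0 i)) free] := frameE Uq.
apply/rowP => i; rewrite [RHS]mxE; apply: (free _ i).
set e := \sum_i _; apply/eqP/negPn/negP => /(metric_pos g).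
rewrite (_ : g q e e = 0) ?ltxx//.
rewrite {2}/e metric_sym metric_sum big1// => j _.
rewrite metricZ metric_sym /e metric_sum.
have : (c *m gram q) 0 j = 0 by rewrite cG mxE.
rewrite mxE => G0; rewrite [X in _ * X](_ : _ = 0) ?mulr0// -[RHS]G0.
by apply: eq_bigr => l _; rewrite metricZ; congr (_ * _); rewrite mxE.
Qed.

Let coef (v : forall q : M, tangent q) (q : M) : 'rV[R]_n :=
  (\row_j g q (v q) (E j q)) *m invmx (gram q).

Let frame_proj v q := \sum_i coef v q 0 i *: E i q.

Let frame_projP v q : U q ->
  D q (frame_proj v q) /\ orth_compl (v q - frame_proj v q).
Proof.
move=> Uq; have [DE _] := frameE Uq; split; first by apply/DE; eexists.
suff ort j : g q (v q - frame_proj v q) (E j q) = 0.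
  move=> w /DE[a ->]; rewrite metric_sym metric_sum big1// => j _.
  by rewrite metricZ metric_sym ort mulr0.
rewrite metricB metric_sum; apply/eqP; rewrite subr_eq0; apply/eqP.
have : (coef v q *m gram q) 0 j = (\row_j g q (v q) (E j q)) 0 j.
  by rewrite /coef mulmxKV//; exact: gram_unit.
rewrite !mxE => <-; apply: eq_bigr => i _.
by rewrite metricZ; congr (_ * _); rewrite mxE.
Qed.

Lemma proj_at_frame v q : U q ->
  [/\ D q (proj_at (v q)), orth_compl (v q - proj_at (v q)) &
      proj_at (v q) = frame_proj v q].
Proof.
move=> Uq; have [Dp op] := frame_projP v Uq.
by rewrite (proj_at_unique Dp op).
Qed.

Lemma proj_at_smooth_on v :
  smooth_section_on U v -> smooth_section_on U (fun q => proj_at (v q)).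
Proof.
move=> sv f; apply: (smooth_on_eq (f := fun q => frame_proj v q f)) => //.
  by move=> q Uq; have [_ _ ->] := proj_at_frame v Uq.
apply: (smooth_on_eq (f := fun q => \sum_i coef v q 0 i * E i q f)) => //.
  by move=> q _; rewrite tangent_sumE.
apply: smooth_on_sum => // i; apply: smooth_onM => //; last exact: sE.
apply: (smooth_on_eq
    (f := fun q => \sum_j g q (v q) (E j q) * invmx (gram q) j i)) => //.
  by move=> q _; rewrite mxE; apply: eq_bigr => j _; rewrite mxE.
apply: smooth_on_sum => // j; apply: smooth_onM => //.
  by apply: metric_smooth => //; exact: sE.
apply: smooth_on_invmx => // k l.
apply: (smooth_on_eq (f := fun q => g q (E k q) (E l q))) => //.
  by move=> q _; rewrite mxE.
by apply: metric_smooth => //; exact: sE.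
Qed.

End LocalFrame.

Lemma proj_atP p (v : tangent p) : D p (proj_at v) /\ orth_compl (v - proj_at v).
Proof.
have [U [E [_ Up _ frameE]]] := local_frame D p.
have e : {w : forall q : M, tangent q | w p = v}.
  exists (fun q => if pselect (p = q) is left e then
                     eq_rect p (fun q => tangent q) v q e else 0).
  by case: pselect => // e; rewrite (Prop_irrelevance e erefl).
case: e => w <-; have [? ? _] := proj_at_frame frameE w Up.
by split.
Qed.

Lemma proj_smooth X : smooth_section_on [set: M] (fun p => proj_at (X p)).
Proof.
move=> f; apply: smooth_on_local => p _.
have [U [E [oU Up sE frameE]]] := local_frame D p.
exists U => //; apply: (proj_at_smooth_on oU sE frameE) => h.
exact: smooth_onS (vfield_smooth X h).
Qed.

Definition distr_proj X : VF := MkVfield (proj_smooth X).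

(* As TM is the orthogonal sum of D and its complement, the orthogonal
   projection onto the complement is the complementary projection. *)
Definition orth_proj X : VF := X - distr_proj X.

Lemma projP X : in_distr (distr_proj X) /\ in_orth (X - distr_proj X).
Proof.
split=> p; first by case: (proj_atP (X p)).
by rewrite vfieldBE; case: (proj_atP (X p)).
Qed.

Lemma proj_orthP X : in_orth (orth_proj X) /\
  forall p w, orth_compl w -> g p ((X - orth_proj X) p) w = 0.
Proof.
split=> [|p w Ow]; first by case: (projP X).
by rewrite /orth_proj subKr metric_sym Ow//; case: (projP X) => /(_ p).
Qed.

Variable nabla : VF -> VF -> VF.

Definition second_form X Y : VF := orth_proj (nabla X Y).

(* g (A_xi X) Y = g (B X Y) xi determines A_xi X in Gamma(D) uniquely. *)
Definition shape_op xi X : VF := xget 0 [set V | in_distr V /\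
  forall Y, in_distr Y -> metric_vf V Y = metric_vf (second_form X Y) xi].

Definition normal_conn X xi : VF := orth_proj (nabla X xi).

Variable U : VF.
Local Notation nablah := (ssnm nabla U).

Definition ssnm_shape_op xi X : VF := shape_op xi X - metric_vf U xi *: X.

Definition ssnm_distr X Y : VF := distr_proj (nablah X Y).

Definition ssnm_distr_curvature X Y Z : VF :=
  ssnm_distr X (ssnm_distr Y Z) - ssnm_distr Y (ssnm_distr X Z)
  - ssnm_distr (distr_proj (bracket X Y)) Z
  - distr_proj (bracket (orth_proj (bracket X Y)) Z).

Definition ssnm_deriv_second_form X Y Z : VF :=
  normal_conn X (second_form Y Z) - second_form (ssnm_distr X Y) Z
  - second_form Y (ssnm_distr X Z).

Definition ssnm_normal_curvature X Y xi : VF :=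
  normal_conn X (normal_conn Y xi) - normal_conn Y (normal_conn X xi)
  - normal_conn (distr_proj (bracket X Y)) xi
  - orth_proj (nablah (orth_proj (bracket X Y)) xi).

End Subbundle.
End MetricGeometry.

(* Main.v *)
From HB Require Import structures.
Require Import Defs.
From mathcomp Require Import all_boot all_order all_algebra reals.
From mathcomp Require Import classical_sets.
From mathcomp Require Import ring.

Import Order.TTheory GRing.Theory Num.Theory.
Local Open Scope ring_scope.

(** Write [P] and [Q] for the orthogonal projections onto the distribution and
    onto its orthogonal complement, [nabla] for the Levi-Civita connection and
    [nablah] for the semi-symmetric one. Both connections are additive in both
    arguments, so each equation follows by splitting the two nested derivatives
    in the curvature, and the term along the bracket, into their [P]- and
    [Q]-components.

    Three facts do the work. First, differentiating along a section of the
    distribution, [nablah_X V] differs from [nabla_X V] by a multiple of [X],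
    which [Q] kills; hence [Q (nablah_X V)] is the second fundamental form of
    [P V] plus the normal derivative of [Q V] ([orth_proj_ssnm_along_distr]).
    Second, since [nabla] preserves [g], the tangential part of the derivative
    of a section orthogonal to the distribution is minus the adjoint of the
    second fundamental form ([metric_connection_orth]); this gives the quadratic
    terms of the Gauss equation ([metric_ssnm_along_distr]) and identifies the
    shape operator in the Ricci equation ([shape_opE],
    [distr_proj_ssnm_orth]). Third, the distribution being non integrable, the
    bracket [K] of two of its sections has a component [Q K], along which
    sections of the distribution must be differentiated too. As [nabla] has no
    torsion, [nabla_(Q K) Z] is the bracket of [Q K] and [Z] plus
    [nabla_Z (Q K)], to which the previous facts apply
    ([metric_ssnm_on_distr], [orth_proj_ssnm_on_distr]).

    In the Codazzi equation [P K] must moreover be written through the induced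
    connection, whose torsion is not zero: it contributes the two terms
    [omega X *: B Y Z] and [omega Y *: B X Z] ([second_form_bracket]). *)

(** * Affine connections *)

Section AffineConnection.
Set Implicit Arguments.
Unset Strict Implicit.
Context {R : realType} {m : nat} {M : smoothManifold R m}.
Implicit Types (X Y Z U : vfield M) (nabla : vfield M -> vfield M -> vfield M).

Lemma vfield_ext X Y : (forall p f, X p f = Y p f) -> X = Y.
Proof. by move=> XY; apply: vfield_eq => p; apply: tangent_eq. Qed.

Lemma connectionDl nabla : affine_connection nabla ->
  forall X Y Z, nabla (X + Y) Z = nabla X Z + nabla Y Z.
Proof.
move=> nablaA X Y Z.
by rewrite -{1}(scale1r X) (connection_linearl nablaA) scale1r.
Qed.

Lemma connectionBl nabla : affine_connection nabla ->
  forall X Y Z, nabla (X - Y) Z = nabla X Z - nabla Y Z.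
Proof.
move=> nablaA X Y Z.
by rewrite addrC -scaleN1r (connection_linearl nablaA) scaleN1r addrC.
Qed.

Lemma connectionZl nabla : affine_connection nabla ->
  forall (f : Cinfty M) X Z, nabla (f *: X) Z = f *: nabla X Z.
Proof.
move=> nablaA f X Z; apply: (addIr (nabla 0 Z)).
by rewrite -connectionDl// -connection_linearl.
Qed.

End AffineConnection.

(** Identities between vector fields that hold in any module over the smooth
    functions are scalar identities once evaluated at a point and at a function,
    where they are within the reach of [ring]. *)
Ltac vfield_ring := apply: vfield_ext => ? ?;
  rewrite ?(vfieldDE, vfieldNE, vfieldZE, tangentDE, tangentNE, tangentZE,
    CinftyD, CinftyN, CinftyM); ring.

(** * The metric on vector fields and the semi-symmetric connection *)

Section Metric.
Set Implicit Arguments.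
Unset Strict Implicit.
Context {R : realType} {m : nat} {M : smoothManifold R m}.
Context (g : riemannianMetric M).
Implicit Types (X Y Z U : vfield M) (nabla : vfield M -> vfield M -> vfield M).

Lemma metric_vfC X Y : metric_vf g X Y = metric_vf g Y X.
Proof. by apply: Cinfty_eq => p; exact: metric_sym. Qed.

Lemma metric_vfDl X Y Z :
  metric_vf g (X + Y) Z = metric_vf g X Z + metric_vf g Y Z.
Proof. by apply: Cinfty_eq => p; exact: metricD. Qed.

Lemma metric_vfZl (f : Cinfty M) X Z :
  metric_vf g (f *: X) Z = f * metric_vf g X Z.
Proof. by apply: Cinfty_eq => p; exact: metricZ. Qed.

Lemma metric_vfNl X Z : metric_vf g (- X) Z = - metric_vf g X Z.
Proof. by rewrite -scaleN1r metric_vfZl mulN1r. Qed.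

Lemma metric_vfDr X Y Z :
  metric_vf g Z (X + Y) = metric_vf g Z X + metric_vf g Z Y.
Proof. by rewrite metric_vfC metric_vfDl !(metric_vfC _ Z). Qed.

Lemma metric_vfZr (f : Cinfty M) X Z :
  metric_vf g Z (f *: X) = f * metric_vf g Z X.
Proof. by rewrite metric_vfC metric_vfZl metric_vfC. Qed.

Lemma ssnm_affine nabla U :
  affine_connection nabla -> affine_connection (ssnm g nabla U).
Proof.
move=> nablaA; split=> [f X Y Z|X Y Z|f X Y]; rewrite /ssnm.
- rewrite (connection_linearl nablaA); vfield_ring.
- rewrite (connection_addr nablaA) metric_vfDr; vfield_ring.
- rewrite (connection_leibniz nablaA) metric_vfZr; vfield_ring.
Qed.

End Metric.

(** * Projections onto the distribution and its complement *)

Section Projections.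
Set Implicit Arguments.
Unset Strict Implicit.
Context {R : realType} {m : nat} {M : smoothManifold R m}.
Context (g : riemannianMetric M).
Context {n : nat}.
Context (D : subbundle M n).
Implicit Types (X Y Z W xi : vfield M).
Local Notation P := (distr_proj g D).
Local Notation Q := (orth_proj g D).

Lemma in_distr_linear (f : Cinfty M) X Y :
  in_distr D X -> in_distr D Y -> in_distr D (f *: X + Y).
Proof. by move=> DX DY p; exact: fibre_closed. Qed.

(** The difference of [X] and [Y] is itself an admissible test field, and it
    has zero square norm. *)
Lemma in_distr_inj X Y : in_distr D X -> in_distr D Y ->
  (forall W, in_distr D W -> metric_vf g X W = metric_vf g Y W) -> X = Y.
Proof.
move=> DX DY XY; have DXY : in_distr D (X - Y).
  by rewrite addrC -scaleN1r; exact: in_distr_linear.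
apply: vfield_eq => p; apply/eqP; rewrite -subr_eq0.
apply/negPn/negP => /(metric_pos g).
have := congr1 (@Cinfty_fun _ _ M ^~ p) (XY _ DXY).
by rewrite /= -!vfieldBE {2}vfieldBE metricB => ->; rewrite subrr ltxx.
Qed.

Lemma distr_proj_unique X Y :
  in_distr D Y -> in_orth g D (X - Y) -> P X = Y.
Proof.
by move=> DY OXY; apply: vfield_eq => p /=; exact: proj_at_unique.
Qed.

Lemma distr_proj_in X : in_distr D (P X). Proof. by case: (projP g D X). Qed.

Lemma orth_proj_in X : in_orth g D (Q X). Proof. by case: (projP g D X). Qed.

Lemma distr_projDorth X : P X + Q X = X. Proof. by rewrite addrC subrK. Qed.

Fact distr_proj_linear : linear P.
Proof.
move=> f X Y; apply: distr_proj_unique.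
  by apply: in_distr_linear; exact: distr_proj_in.
rewrite (_ : _ - _ = f *: Q X + Q Y); last by rewrite /orth_proj; vfield_ring.
by move=> p w Dw; rewrite metric_linear !orth_proj_in// mulr0 addr0.
Qed.
HB.instance Definition _ :=
  GRing.isLinear.Build (Cinfty M) (vfield M) (vfield M) *:%R P
    distr_proj_linear.

Fact orth_proj_linear : linear Q.
Proof. by move=> f X Y; rewrite /orth_proj linearP; vfield_ring. Qed.
HB.instance Definition _ :=
  GRing.isLinear.Build (Cinfty M) (vfield M) (vfield M) *:%R Q
    orth_proj_linear.

Lemma orth_proj_distr X : in_distr D X -> Q X = 0.
Proof.
move=> DX; rewrite /orth_proj (@distr_proj_unique X X) ?subrr// => p w _.
by rewrite metric0.
Qed.

Lemma distr_proj_id X : in_distr D X -> P X = X.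
Proof.
by move=> DX; rewrite -[RHS](distr_projDorth X) orth_proj_distr// addr0.
Qed.

Lemma distr_proj_orth xi : in_orth g D xi -> P xi = 0.
Proof.
move=> Oxi; apply: distr_proj_unique; last by rewrite subr0.
by rewrite -(linear0 P); exact: distr_proj_in.
Qed.

Lemma orth_proj_orth xi : in_orth g D xi -> Q xi = xi.
Proof. by move=> Oxi; rewrite /orth_proj distr_proj_orth// subr0. Qed.

Lemma metric_orth_distr xi W :
  in_orth g D xi -> in_distr D W -> metric_vf g xi W = 0.
Proof. by move=> Oxi DW; apply: Cinfty_eq => p; exact: Oxi. Qed.

Lemma metric_distr_proj X W :
  in_distr D W -> metric_vf g (P X) W = metric_vf g X W.
Proof.
move=> DW; rewrite -[in RHS](distr_projDorth X) metric_vfDl.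
by rewrite (metric_orth_distr (orth_proj_in X))// addr0.
Qed.

Lemma metric_orth_proj X xi :
  in_orth g D xi -> metric_vf g (Q X) xi = metric_vf g X xi.
Proof.
move=> Oxi; rewrite -[in RHS](distr_projDorth X) metric_vfDl.
by rewrite (metric_vfC _ (P X)) (metric_orth_distr Oxi (distr_proj_in X)) add0r.
Qed.

End Projections.

(** * Components of covariant derivatives *)

Section Decomposition.
Set Implicit Arguments.
Unset Strict Implicit.
Context {R : realType} {m : nat} {M : smoothManifold R m}.
Context {g : riemannianMetric M}.
Context {nabla : vfield M -> vfield M -> vfield M}.
Context (nablaP : levi_civita g nabla).
Context {n : nat}.
Context (D : subbundle M n).
Context (U : vfield M).
Implicit Types (X Y Z V W K xi : vfield M).
Local Notation P := (distr_proj g D).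
Local Notation Q := (orth_proj g D).
Local Notation B := (second_form g D nabla).
Local Notation Lo := (normal_conn g D nabla).
Local Notation nablah := (ssnm g nabla U).
Local Notation nablahD := (ssnm_distr g D nabla U).

Let nablaA := levi_civita_connection nablaP.
Let nablahA := ssnm_affine g U nablaA.

(** Weingarten formula: [g(xi, W)] vanishes identically, so its derivative along
    [X] does too; as [nabla] preserves [g], this derivative is the sum of
    [g(nabla_X xi, W)] and [g(xi, nabla_X W)]. *)
Lemma metric_connection_orth X xi W : in_orth g D xi -> in_distr D W ->
  metric_vf g (nabla X xi) W = - metric_vf g xi (B X W).
Proof.
move=> Oxi DW; apply/eqP; rewrite -addr_eq0 (metric_vfC g xi).
rewrite metric_orth_proj// (metric_vfC g _ xi) -(levi_civita_metric nablaP).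
rewrite (metric_orth_distr Oxi DW); apply/eqP/Cinfty_eq => p.
by apply: (addIr (X p 0)); rewrite /= -tangentD !add0r.
Qed.

(** By the Weingarten formula the right-hand side is a smooth field with the
    defining property of the shape operator; without such a field the choice in
    that definition would return a default value. *)
Lemma shape_opE xi X :
  in_orth g D xi -> shape_op g D nabla xi X = - P (nabla X xi).
Proof.
move=> Oxi; pose A := - P (nabla X xi).
have DA : in_distr D A by rewrite /A -linearN; exact: distr_proj_in.
have AE Y : in_distr D Y -> metric_vf g A Y = metric_vf g (B X Y) xi.
  move=> DY; rewrite metric_vfNl metric_distr_proj// metric_connection_orth//.
  by rewrite opprK metric_vfC.
apply: xget_unique => // V [DV VE].
by apply: (in_distr_inj (g := g) DV DA) => Y DY; rewrite VE// AE.
Qed.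

Lemma second_formN X V : B X (- V) = - B X V.
Proof.
rewrite /second_form -linearN; congr Q; apply: (addIr (nabla X V)).
rewrite -(connection_addr nablaA) !addNr; apply: (addIr (nabla X 0)).
by rewrite -(connection_addr nablaA) addr0 add0r.
Qed.

(** The correction [omega(xi) X] to the connection is exactly the correction
    [- omega(xi) Id] to the shape operator. *)
Lemma distr_proj_ssnm_orth X xi : in_distr D X -> in_orth g D xi ->
  P (nablah X xi) = - ssnm_shape_op g D nabla U xi X.
Proof.
move=> DX Oxi; rewrite /ssnm_shape_op shape_opE// /ssnm linearD linearZ/=.
by rewrite (distr_proj_id g DX); vfield_ring.
Qed.

Lemma orth_proj_ssnm X V : in_distr D X -> Q (nablah X V) = Q (nabla X V).
Proof.
by move=> DX; rewrite linearD linearZ/= (orth_proj_distr g DX) scaler0 addr0.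
Qed.

(** Applied to [V = nablah_Y Z], or to [V = nablah_Y xi], this decomposes the
    second derivatives in the Codazzi and Ricci equations. *)
Lemma orth_proj_ssnm_along_distr X V :
  in_distr D X -> Q (nablah X V) = B X (P V) + Lo X (Q V).
Proof.
move=> DX; rewrite orth_proj_ssnm// -linearD -connection_addr//.
by rewrite distr_projDorth.
Qed.

(** The counterpart for the Gauss equation. The orthogonal component [Q V]
    contributes a term that is quadratic in the second fundamental form, by the
    Weingarten formula, and one that comes from [omega (Q V) *: X]. *)
Lemma metric_ssnm_along_distr X V W : in_distr D X -> in_distr D W ->
  metric_vf g (nablah X V) W = metric_vf g (nablahD X (P V)) W
    - metric_vf g (B X W) (Q V) + metric_vf g X W * metric_vf g U (Q V).
Proof.
move=> DX DW; rewrite metric_distr_proj// -[in LHS](distr_projDorth g D V).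
rewrite (connection_addr nablahA) metric_vfDl -addrA; congr (_ + _).
rewrite /ssnm metric_vfDl metric_vfZl; congr (_ + _); last exact: mulrC.
rewrite metric_connection_orth//; last exact: orth_proj_in.
by rewrite metric_vfC.
Qed.

(** The induced connection is semi-symmetric in its turn: its torsion is
    [omega(Y) X - omega(X) Y]. *)
Lemma distr_proj_bracket X Y : in_distr D X -> in_distr D Y ->
  P (bracket X Y) = nablahD X Y - nablahD Y X
    - metric_vf g U Y *: X + metric_vf g U X *: Y.
Proof.
move=> DX DY; rewrite -(levi_civita_torsion_free nablaP).
rewrite /ssnm_distr /ssnm !linearB !linearD !linearZ/=.
rewrite (distr_proj_id g DX) (distr_proj_id g DY); vfield_ring.
Qed.

Lemma second_form_bracket X Y Z : in_distr D X -> in_distr D Y ->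
  B (P (bracket X Y)) Z = B (nablahD X Y) Z - B (nablahD Y X) Z
    - metric_vf g U Y *: B X Z + metric_vf g U X *: B Y Z.
Proof.
move=> DX DY; rewrite distr_proj_bracket// /second_form.
rewrite (connectionDl nablaA) 2!(connectionBl nablaA) 2!(connectionZl nablaA).
by rewrite linearD/= 2!linearB/= !(linearZ_LR Q).
Qed.

Lemma ssnm_orth_bracket K Z :
  nablah (Q K) Z = bracket (Q K) Z + nabla Z (Q K) + metric_vf g U Z *: Q K.
Proof. by rewrite -(levi_civita_torsion_free nablaP) subrK. Qed.

(** Here [K] is arbitrary, in the applications a bracket of sections of the
    distribution. The last term measures non-integrability: torsion-freeness
    turns [nabla_(Q K) Z] into [nabla_Z (Q K)], and the Weingarten formula then
    produces [B Z W] paired with [K]. *)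
Lemma metric_ssnm_on_distr K Z W : in_distr D Z -> in_distr D W ->
  metric_vf g (nablah K Z) W = metric_vf g (nablahD (P K) Z) W
    + metric_vf g (P (bracket (Q K) Z)) W - metric_vf g (B Z W) K.
Proof.
move=> DZ DW; rewrite !metric_distr_proj//.
rewrite -[in LHS](distr_projDorth g D K) (connectionDl nablahA) metric_vfDl.
rewrite -[RHS]addrA; congr (_ + _).
rewrite ssnm_orth_bracket 2!metric_vfDl metric_vfZl.
have OK : in_orth g D (Q K) by exact: orth_proj_in.
rewrite (metric_orth_distr OK DW) mulr0 addr0; congr (_ + _).
rewrite metric_connection_orth// metric_orth_proj; last exact: orth_proj_in.
by rewrite metric_vfC.
Qed.

Lemma orth_proj_ssnm_splitl K V :
  Q (nablah K V) = Lo (P K) V + Q (nablah (Q K) V).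
Proof.
rewrite -[in LHS](distr_projDorth g D K) (connectionDl nablahA) linearD/=.
by rewrite orth_proj_ssnm//; exact: distr_proj_in.
Qed.

Lemma orth_proj_ssnm_on_distr K Z : in_distr D Z ->
  Q (nablah K Z) = B (P K) Z + Q (bracket (Q K) Z) + Lo Z (Q K)
    + metric_vf g U Z *: Q K.
Proof.
move=> DZ; rewrite orth_proj_ssnm_splitl ssnm_orth_bracket 2!linearD linearZ/=.
rewrite !addrA; congr (_ + _ *: _).
by rewrite orth_proj_orth//; exact: orth_proj_in.
Qed.

End Decomposition.

Theorem theorem3p3 (R : realType) (m : nat) (M : smoothManifold R m)
    (g : riemannianMetric M)
    (nabla : vfield M -> vfield M -> vfield M) (nablaP : levi_civita g nabla)
    (n : nat) (D : subbundle M n) (D_non_integrable : non_integrable D)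
    (U : vfield M) (X Y Z W xi : vfield M)
    (DX : in_distr D X) (DY : in_distr D Y) (DZ : in_distr D Z)
    (DW : in_distr D W) (Oxi : in_orth g D xi) :
  let omega := metric_vf g U in
  let piO := orth_proj g D in
  let B := second_form g D nabla in
  let Lo := normal_conn g D nabla in
  let Rh := curvature (ssnm g nabla U) in
  let RhD := ssnm_distr_curvature g D nabla U in
  let LhB := ssnm_deriv_second_form g D nabla U in
  let Ah := ssnm_shape_op g D nabla U in
  let RhL := ssnm_normal_curvature g D nabla U in
  [/\ (* Gauss *)
      metric_vf g (Rh X Y Z) W =
        metric_vf g (RhD X Y Z) W
        - metric_vf g (B X W) (B Y Z) + metric_vf g (B Y W) (B X Z)
        + metric_vf g X W * omega (B Y Z) - metric_vf g Y W * omega (B X Z)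
        + metric_vf g (B Z W) (bracket X Y),
      (* Codazzi *)
      piO (Rh X Y Z) =
        LhB X Y Z - LhB Y X Z - omega X *: B Y Z + omega Y *: B X Z
        - piO (bracket (piO (bracket X Y)) Z)
        - Lo Z (piO (bracket X Y)) - omega Z *: piO (bracket X Y)
    & (* Ricci *)
      piO (Rh X Y xi) = - B X (Ah xi Y) + B Y (Ah xi X) + RhL X Y xi].
Proof.
have nablaA := levi_civita_connection nablaP.
have nablahA := ssnm_affine g U nablaA.
move=> omega piO B Lo Rh RhD LhB Ah RhL.
rewrite /Rh /RhD /LhB /Ah /RhL /curvature /ssnm_distr_curvature.
rewrite /ssnm_deriv_second_form /ssnm_normal_curvature; split.
  (* The sums are split a fixed number of times, since the covariant derivatives
     themselves unfold to sums. *)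
- rewrite 2![in LHS]metric_vfDl 2![in LHS]metric_vfNl.
  rewrite 3![in RHS]metric_vfDl 3![in RHS]metric_vfNl.
  rewrite (metric_ssnm_along_distr nablaP U (ssnm g nabla U Y Z) DX DW).
  rewrite (metric_ssnm_along_distr nablaP U (ssnm g nabla U X Z) DY DW).
  rewrite (metric_ssnm_on_distr nablaP U (bracket X Y) DZ DW).
  rewrite !orth_proj_ssnm//.
  apply: Cinfty_eq => p; rewrite ?(CinftyD, CinftyN, CinftyM) /=; ring.
- rewrite /piO 2![in LHS]linearB/= (orth_proj_ssnm_on_distr nablaP U _ DZ).
  rewrite (orth_proj_ssnm_along_distr nablaP U (ssnm g nabla U Y Z) DX).
  rewrite (orth_proj_ssnm_along_distr nablaP U (ssnm g nabla U X Z) DY).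
  rewrite !orth_proj_ssnm// (second_form_bracket nablaP U Z DX DY).
  vfield_ring.
- rewrite /piO 2![in LHS]linearB/=.
  rewrite (orth_proj_ssnm_splitl nablaP D U (bracket X Y)).
  rewrite (orth_proj_ssnm_along_distr nablaP U (ssnm g nabla U Y xi) DX).
  rewrite (orth_proj_ssnm_along_distr nablaP U (ssnm g nabla U X xi) DY).
  rewrite !(distr_proj_ssnm_orth nablaP)// !second_formN//.
  rewrite (orth_proj_ssnm U xi DX) (orth_proj_ssnm U xi DY).
  vfield_ring.
Qed.
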